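(* Let $k>0$, $I>0$, $0<A_1\le A_2\le A_3$, $J=\mathrm{diag}(A_1,A_2,A_3)$, and consider the system of ODEs for $(\Omega,\Omega_1)\in\mathbb{R}^3\times\mathbb{R}^3$ $$\dot\Omega=J^{-1}\big(k(\Omega_1-\Omega)-\Omega\times(J\Omega)\big),\qquad \dot\Omega_1=-\frac{k}{I}(\Omega_1-\Omega)-\Omega\times\Omega_1 .$$ Let $(\Omega^*,\Omega_1^* )$ be an equilibrium point of this system such that $\Omega^*=\Omega_1^*$ is an eigenvector of $J$ corresponding to the eigenvalue $\lambda^*\in\{A_1,A_2,A_3\}$. Then $(\Omega^*,\Omega_1^* )$ is normally stable if $\lambda^*=A_3$; otherwise (that is, if $\lambda^*\neq A_3$) it is normally hyperbolic.
   Context: Here $\times$ is the cross product in $\mathbb{R}^3$. Eigenvectors are nonzero. Definition (normally stable / normally hyperbolic). Let $D\subset\mathbb{R}^d$ be open, $f\in C^1(D,\mathbb{R}^d)$, and let $\mathcal{E}=\{z\in D: f(z)=0\}$ be the set of equilibria of $\dot z=f(z)$. For $z^*\in\mathcal{E}$ put $A:=f'(z^* )$ (the Jacobian matrix), $N(\cdot)$ the null space, and $\sigma(A)\subset\mathbb{C}$ the set of complex eigenvalues of $A$. Assume: (1) near $z^*$, $\mathcal{E}$ forms a $C^1$-manifold of dimension $m$, $0<m\le d$: there are an open set $U\subset\mathbb{R}^m$ with $0\in U$ and a $C^1$ function $\psi:U\to\mathbb{R}^d$ with $\psi(U)\subset\mathcal{E}$, $\psi(0)=z^*$ and $\operatorname{rank}\psi'(0)=m$;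 (2) the tangent space $T_{z^*}\mathcal{E}$ of $\mathcal{E}$ at $z^*$ equals $N(A)$; (3) $0$ is a semi-simple eigenvalue of $A$, i.e. $N(A^2)=N(A)$; (4) $\sigma(A)\cap i\mathbb{R}=\{0\}$. Then $z^*$ is called normally stable if (1)-(4) hold and $\sigma(A)\setminus\{0\}\subset\mathbb{C}^-:=\{\lambda\in\mathbb{C}:\mathrm{Re}(\lambda)<0\}$; and $z^*$ is called normally hyperbolic if (1)-(4) hold and $\sigma(A)\cap\mathbb{C}^-\neq\varnothing$ and $\sigma(A)\cap\mathbb{C}^+\neq\varnothing$, where $\mathbb{C}^+:=\{\lambda\in\mathbb{C}:\mathrm{Re}(\lambda)>0\}$. In the claim, this is applied with $d=6$, $D=\mathbb{R}^6$ and $f$ the right-hand side of the system. *)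

(* Defs.v *)
From HB Require Import structures.
From mathcomp Require Import all_boot all_order all_algebra.
From mathcomp Require Import all_classical all_reals all_analysis.
From mathcomp.real_closed Require Import complex.

Set Implicit Arguments.
Unset Strict Implicit.
Unset Printing Implicit Defensive.

Import Order.TTheory GRing.Theory Num.Theory.
Import numFieldNormedType.Exports.

Local Open Scope classical_set_scope.
Local Open Scope ring_scope.

(* Vectors are row vectors and matrices act on the right, as in [jacobian]:
   the derivative of g at z maps v to v *m jacobian g z, so [jacobian g z] is
   the transpose of the usual Jacobian matrix, null spaces are [kermx] and
   ranges are row spaces. *)

Section stability.
Variable R : realType.

Definition is_C1 (m n : nat) (D : set 'rV[R]_m) (g : 'rV[R]_m -> 'rV[R]_n) :=
  forall x, D x -> differentiable g x /\ {for x, continuous (jacobian g)}.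

Definition spectrum (n : nat) (A : 'M[R]_n) : set R[i] :=
  [set l | eigenvalue (map_mx (real_complex R) A) l].

Definition left_half_plane : set R[i] := [set l | complex.Re l < 0].
Definition imaginary_axis : set R[i] := [set l | complex.Re l = 0].
Definition right_half_plane : set R[i] := [set l | 0 < complex.Re l].

Section equilibrium.
Variables (d : nat) (D : set 'rV[R]_d) (f : 'rV[R]_d -> 'rV[R]_d).

Definition equilibria : set 'rV[R]_d := [set z | D z /\ f z = 0].

Definition equilibrium_chart (z : 'rV[R]_d) (m : nat)
    (U : set 'rV[R]_m) (psi : 'rV[R]_m -> 'rV[R]_d) :=
  [/\ open U /\ U 0, is_C1 U psi, psi @` U `<=` equilibria, psi 0 = z
    & \rank (jacobian psi 0) = m].

(* The tangent space of the manifold of equilibria at z is the range of the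
   derivative at 0 of its parametrization psi. *)
Definition regular_equilibrium (z : 'rV[R]_d) :=
  let A := jacobian f z in
  [/\ [/\ open D, is_C1 D f & equilibria z],
      exists (m : nat) (U : set 'rV[R]_m) (psi : 'rV[R]_m -> 'rV[R]_d),
        [/\ (0 < m <= d)%N, equilibrium_chart z U psi
          & (jacobian psi 0 :=: kermx A)%MS],
      (kermx (A *m A) :=: kermx A)%MS
    & spectrum A `&` imaginary_axis = [set 0]].

Definition normally_stable (z : 'rV[R]_d) :=
  regular_equilibrium z /\
  spectrum (jacobian f z) `\ 0 `<=` left_half_plane.

Definition normally_hyperbolic (z : 'rV[R]_d) :=
  [/\ regular_equilibrium z,
      spectrum (jacobian f z) `&` left_half_plane !=set0
    & spectrum (jacobian f z) `&` right_half_plane !=set0].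

End equilibrium.
End stability.

Section system.
Variable R : realType.

Definition crossmul (u v : 'rV[R]_3) : 'rV[R]_3 :=
  \row_j [:: u 0 1 * v 0 2 - u 0 2 * v 0 1;
             u 0 2 * v 0 0 - u 0 0 * v 0 2;
             u 0 0 * v 0 1 - u 0 1 * v 0 0]`_j.

Definition diag3 (a b c : R) : 'M[R]_3 := diag_mx (\row_j [:: a; b; c]`_j).

Definition is_eigenvector (n : nat) (A : 'M[R]_n) (l : R) (v : 'rV[R]_n) :=
  v != 0 /\ v *m A = l *: v.

(* The state is z = row_mx Omega Omega1; J is symmetric, so the column vector
   J Omega is written Omega *m J. *)
Definition rhs (k I : R) (J : 'M[R]_3) (z : 'rV[R]_(3 + 3)) : 'rV[R]_(3 + 3) :=
  let Omega := lsubmx z in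
  let Omega1 := rsubmx z in
  row_mx ((k *: (Omega1 - Omega) - crossmul Omega (Omega *m J)) *m invmx J)
         (- (k / I) *: (Omega1 - Omega) - crossmul Omega Omega1).

End system.

(* Main.v *)
Require Import Defs.
From HB Require Import structures.
From mathcomp Require Import all_boot all_order all_algebra.
From mathcomp Require Import all_classical all_reals all_analysis.
From mathcomp.real_closed Require Import complex.
From mathcomp Require Import ring lra.

Set Implicit Arguments.
Unset Strict Implicit.
Unset Printing Implicit Defensive.

Import Order.TTheory GRing.Theory Num.Theory.
Import numFieldNormedType.Exports.

Local Open Scope classical_set_scope.
Local Open Scope ring_scope.

(** Write w for the common value of the two angular velocities, A for the
    derivative at (w, w), and (u, v) for a perturbation; put y = v - u. Since
    w J = lam w, the image (u', v') of (u, v) is given by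
      u' J = k y - w x (u J - lam u),   v' = - (k / I) y - w x y.

    The kernel consists of the (u, u) with u J = lam u, and those u give
    equilibria, so the equilibria near (w, w) contain the affine space through
    (w, w) in the direction of the kernel ([kernelP], [equilibrium_manifold]).
    Scalar products with w, n and w x n show that no nonzero (n, n) in the
    kernel is in the range of A ([kernel_semisimple]).

    For the other eigenvalues: along the flow the kinetic energy E decreases at
    the rate k |Omega1 - Omega|^2 and the length of the angular momentum
    M = Omega J + I Omega1 is constant. The combination E - |M|^2 / (2 (lam + I)) is critical at
    (w, w), so its second derivative Q there decreases along the linearized
    flow: Q((u, v), (u, v) A) = - k |y|^2 ([energy_dissipation]). For an
    eigenvalue mu with eigenvector x + i x' this reads
      Re mu (Q(x, x) + Q(x', x')) = - k (|y|^2 + |y'|^2),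
    and the right-hand side vanishes only for mu = 0 ([energy_eigenvector]).
    So no nonzero eigenvalue is imaginary. If lam is the largest moment of
    inertia then Q >= 0, whence Re mu < 0 ([normally_stable_top]).

    A negative eigenvalue always exists: perturbations parallel to w form an
    invariant plane on which Omega and Omega1 relax to each other
    ([spectrum_left]). If lam < A3, the perturbations whose two components are
    orthogonal to w, that is, lie in the plane of e3 and w x e3, form an invariant
    space of dimension 4. Its characteristic polynomial violates one of the necessary stability conditions
    of Routh and Hurwitz ([quartic_hurwitz]), hence it has a root with positive
    real part ([transverse_charpoly_unstable], [spectrum_right]). *)

(** * Stability of real quartic polynomials *)

Section quartic_stability.
Local Open Scope complex_scope.

Lemma pair_sum_prod_real (R : rcfType) (z w : R[i]) :
  complex.Re z <= 0 -> complex.Re w <= 0 ->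
  complex.Im (z + w) = 0 -> complex.Im (z * w) = 0 ->
  exists b c : R, [/\ 0 <= b, 0 <= c, z + w = (- b)%:C & z * w = c%:C].
Proof.
rewrite raddfD /=; case: z => x y; case: w => x' y'; simpc => /= hx hx' hy hyx.
have {}hy : y' = - y by lra.
rewrite hy in hyx *.
exists (- (x + x')), (x * x' + y ^+ 2); split; first by lra.
- by rewrite addr_ge0 ?sqr_ge0 // mulr_le0.
- by apply/eqP; rewrite eq_complex /= opprK addrN !eqxx.
- apply/eqP; rewrite eq_complex /=; apply/andP; split; apply/eqP; last by lra.
  by ring.
Qed.

(** The roots of a real polynomial are stable under conjugation. If they are all
    real, any pairing will do; otherwise a nonreal root is paired with its
    conjugate, which leaves a monic real quadratic with the two other roots. *)
Lemma quartic_real_pairing (R : rcfType) (r : seq R[i]) (p : {poly R}) (c : R) :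
  size r = 4 -> c != 0 ->
  map_poly (real_complex R) p = c%:C *: \prod_(z <- r) ('X - z%:P) ->
  exists z1 z2 z3 z4, [/\ perm_eq r [:: z1; z2; z3; z4],
    complex.Im (z1 + z2) = 0, complex.Im (z1 * z2) = 0, complex.Im (z3 + z4) = 0
   & complex.Im (z3 * z4) = 0].
Proof.
move=> szr c0 pE.
have evalr x : complex.Im (\prod_(z <- r) (x%:C - z)) = 0.
  have := congr1 (fun q => complex.Im (q.[x%:C])) pE.
  rewrite /= horner_map hornerZ horner_prod.
  under eq_bigr do rewrite hornerXsubC.
  case: (\prod_(_ <- _) _) => u v; simpc => /= /eqP.
  by rewrite eq_sym mulf_eq0 (negPf c0) => /eqP.
have [allreal|/allPn [z zr zim]] := boolP (all (fun z => complex.Im z == 0) r).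
  case: r szr allreal {pE evalr} => [|z1 [|z2 [|z3 [|z4 [|]]]]] //= _.
  case: z1 z2 z3 z4 => [a1 b1] [a2 b2] [a3 b3] [a4 b4] /=.
  move=> /and5P[/eqP-> /eqP-> /eqP-> /eqP-> _].
  exists a1%:C, a2%:C, a3%:C, a4%:C; split; simpc; rewrite //= ?addr0 //.
have zcr : z^* \in r.
  have c0' : c%:C != 0 by apply: contra c0 => /eqP /complexI ->.
  rewrite -root_prod_XsubC -(rootZ _ _ c0') -pE -complex_root_conj -map_poly_comp.
  have -> : map_poly (conjc \o real_complex R) p = map_poly (real_complex R) p.
    by apply: eq_map_poly => x; apply: conjc_real.
  by rewrite pE rootZ // root_prod_XsubC.
have zzc : z^* != z.
  apply: contra zim; case: (z) => u v; rewrite eq_complex /= eqxx /= => /eqP h.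
  by apply/eqP; lra.
have := perm_to_rem zr; have /perm_to_rem : z^* \in rem z r by exact: rem_mem.
have : size (rem z^* (rem z r)) = 2.
  by rewrite !size_rem ?szr //; apply: rem_mem.
case: (rem _ (rem z r)) => [|z3 [|z4 [|]]] //= _ p1 p2.
have {p1 p2} rE : perm_eq r [:: z; z^*; z3; z4].
  by rewrite (perm_trans p2) // perm_cons.
exists z, z^*, z3, z4.
(* For real x the factors of z and its conjugate have a nonzero real product. *)
have {}evalr x : complex.Im ((x%:C - z3) * (x%:C - z4)) = 0.
  have := evalr x; rewrite (perm_big _ rE) !big_cons big_nil /= mulr1.
  rewrite mulrA.
  have -> : (x%:C - z) * (x%:C - z^*) =
    ((x - complex.Re z) ^+ 2 + complex.Im z ^+ 2)%:C.
    case: (z) => u v; simpc; apply/eqP; rewrite eq_complex /=.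
    by apply/andP; split; apply/eqP; ring.
  case: ((x%:C - z3) * _) => u v; simpc => /= /eqP.
  rewrite mulf_eq0 => /orP [|/eqP //].
  by rewrite paddr_eq0 ?sqr_ge0 // !sqrf_eq0 (negPf zim) andbF.
split=> //.
- by case: (z) => u v; simpc; rewrite /= ?addrN.
- by case: (z) => u v; rewrite /=; ring.
- have := evalr 1; have := evalr 0.
  by case: (z3) (z4) => [a3 b3] [a4 b4]; simpc => /=; lra.
- have := evalr 0.
  by case: (z3) (z4) => [a3 b3] [a4 b4]; simpc => /=; lra.
Qed.

Lemma cubic_coef_eq0 (F : numFieldType) (d3 d2 d1 d0 : F) :
  (forall x, d3 * x ^+ 3 + d2 * x ^+ 2 + d1 * x + d0 = 0) ->
  [/\ d3 = 0, d2 = 0, d1 = 0 & d0 = 0].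
Proof.
move=> h.
have := h 0; have := h 1; have := h (-1); have := h (2); 
rewrite !expr0n !expr1n /= => e2 em e1 e0.
have {}e0 : d0 = 0 by rewrite -e0; ring.
have h3 : 6%:R * d3 = 0.
  rewrite e0 in e2 em e1.
  have -> : 6%:R * d3 = (d3 * 2 ^+ 3 + d2 * 2 ^+ 2 + d1 * 2 + 0)
     - 3 * (d3 * 1 + d2 * 1 + d1 * 1 + 0)
     - (d3 * (-1) ^+ 3 + d2 * (-1) ^+ 2 + d1 * (-1) + 0) by ring.
  by rewrite e2 em e1; ring.
have {}h3 : d3 = 0 by move/eqP: h3; rewrite mulf_eq0 pnatr_eq0 /= => /eqP.
have h2 : 2%:R * d2 = 0.
  have -> : 2%:R * d2 = (d3 * 1 + d2 * 1 + d1 * 1 + d0)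
     + (d3 * (-1) ^+ 3 + d2 * (-1) ^+ 2 + d1 * (-1) + d0) - 2%:R * d0 by ring.
  by rewrite em e1 e0; ring.
have {}h2 : d2 = 0 by move/eqP: h2; rewrite mulf_eq0 pnatr_eq0 /= => /eqP.
split=> //; by rewrite -e1 e0 h2 h3; ring.
Qed.

(** Some of the necessary Routh-Hurwitz conditions. Pairing the roots writes the
    polynomial as p4 (x^2 + b x + c) (x^2 + d x + e) with b, c, d, e >= 0, and
      p1 p2 p3 - p4 p1^2 - p0 p3^2
        = p4^3 b d ((c - e)^2 + (b + d) (b e + c d)). *)
Lemma quartic_hurwitz (R : rcfType) (p4 p3 p2 p1 p0 : R) : 0 < p4 ->
  (forall z : R[i], p4%:C * z ^+ 4 + p3%:C * z ^+ 3 + p2%:C * z ^+ 2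
     + p1%:C * z + p0%:C = 0 -> complex.Re z <= 0) ->
  [/\ 0 <= p1, 0 <= p0 & p4 * p1 ^+ 2 + p0 * p3 ^+ 2 <= p1 * p2 * p3].
Proof.
move=> p4gt0 stable; have p4n0 : p4 != 0 by rewrite gt_eqF.
pose p : {poly R} := Poly [:: p0; p1; p2; p3; p4].
have szp : size p = 5 by rewrite (@PolyK _ 0).
have lcp : lead_coef p = p4 by rewrite lead_coefE szp /= coef_Poly.
have [r] := closed_field_poly_normal (map_poly (real_complex R) p).
rewrite lead_coef_map_inj ?raddf0 //; last exact: complexI.
rewrite lcp => pE.
have szr : size r = 4.
  have := congr1 (fun q : {poly _} => size q) pE.
  rewrite size_map_inj_poly ?raddf0 //; last exact: complexI.
  rewrite szp size_scale ?size_prod_XsubC; first by case.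
  by apply: contra p4n0 => /eqP /complexI ->.
have [z1 [z2 [z3 [z4 [rE s12 m12 s34 m34]]]]] := quartic_real_pairing szr p4n0 pE.
have re z : z \in r -> complex.Re z <= 0.
  move=> zr; apply: stable.
  have : root (map_poly (real_complex R) p) z.
    rewrite pE rootZ ?root_prod_XsubC //.
    by apply: contra p4n0 => /eqP /complexI ->.
  by rewrite rootE map_Poly horner_Poly /= => /eqP <-; ring.
have re4 : all (fun z => complex.Re z <= 0) [:: z1; z2; z3; z4].
  by apply/allP => z; rewrite -(perm_mem rE); apply: re.
move: re4 => /and5P[h1 h2 h3 h4 _].
have [b [c [b0 c0 sE12 mE12]]] := pair_sum_prod_real h1 h2 s12 m12.
have [d [e [d0 e0 sE34 mE34]]] := pair_sum_prod_real h3 h4 s34 m34.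
have [e3 e2 e1 e0'] : [/\ p3 - p4 * (b + d) = 0, p2 - p4 * (c + e + b * d) = 0,
    p1 - p4 * (b * e + c * d) = 0 & p0 - p4 * (c * e) = 0].
  apply: cubic_coef_eq0 => x; apply: (@complexI R).
  have := congr1 (fun q : {poly _} => q.[x%:C]) pE.
  rewrite horner_map horner_Poly hornerZ horner_prod /=.
  under eq_bigr do rewrite hornerXsubC.
  rewrite (perm_big _ rE) !big_cons big_nil /= => xE.
  have {}xE : ((((p4 * x + p3) * x + p2) * x + p1) * x + p0)%:C =
     (p4 * ((x ^+ 2 + b * x + c) * (x ^+ 2 + d * x + e)))%:C.
    (* The Horner scheme of xE starts with 0 * x + p4. *)
    rewrite -[p4 in LHS]add0r -[0 in LHS](mul0r x) xE !(rmorphD, rmorphM, rmorphXn) /=.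
    have -> : b%:C = - (z1 + z2) by rewrite sE12 rmorphN opprK.
    have -> : d%:C = - (z3 + z4) by rewrite sE34 rmorphN opprK.
    by rewrite -mE12 -mE34; ring.
  move/complexI: xE => xE; congr (_%:C); apply/eqP; rewrite -subr_eq0.
  by apply/eqP; move: xE => /eqP; rewrite -subr_eq0 => /eqP {2}<-; ring.
move: e3 e2 e1 e0' => /subr0_eq-> /subr0_eq-> /subr0_eq-> /subr0_eq->.
have p4ge0 := ltW p4gt0.
split; [by rewrite mulr_ge0 // addr_ge0 // mulr_ge0 | by rewrite !mulr_ge0 |].
rewrite -subr_ge0.
have -> : p4 * (b * e + c * d) * (p4 * (c + e + b * d)) * (p4 * (b + d)) -
    (p4 * (p4 * (b * e + c * d)) ^+ 2 + p4 * (c * e) * (p4 * (b + d)) ^+ 2) =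
   p4 ^+ 3 * (b * d * ((c - e) ^+ 2 + (b + d) * (b * e + c * d))) by ring.
have h : 0 <= b * e + c * d by rewrite addr_ge0 // mulr_ge0.
by apply: mulr_ge0; rewrite ?exprn_ge0 // mulr_ge0 ?mulr_ge0 // addr_ge0
  ?sqr_ge0 // mulr_ge0 // addr_ge0.
Qed.

Lemma quadratic_nonroot (R : rcfType) (p q r : R) (z : R[i]) :
  0 < p -> 0 <= q -> 0 < r -> 0 < complex.Re z ->
  p%:C * z ^+ 2 + q%:C * z + r%:C != 0.
Proof.
case: z => x y /= p0 q0 r0 x0; apply/eqP; rewrite expr2; simpc => -[hre him].
have y0 : y * (2 * p * x + q) = 0 by rewrite -[RHS]him; ring.
have pos : 0 < 2 * p * x + q by rewrite ltr_pwDl // !mulr_gt0.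
move/eqP: y0; rewrite mulf_eq0 (gt_eqF pos) orbF => /eqP y0.
have : 0 < p * x ^+ 2 + q * x + r.
  by rewrite ltr_wpDl // addr_ge0 // mulr_ge0 ?sqr_ge0 // ltW.
by rewrite -[X in _ < X](_ : 0 = _) ?ltxx // -hre y0; ring.
Qed.

(** Up to the factor a b, the characteristic polynomial of the linearization on
    the perturbations orthogonal to w, where S = |w|^2, kap = k / I, and a, b are
    the moments of inertia in the directions e3 and w x e3. *)
Definition transverse_charpoly (F : comNzRingType) (k kap S lam a b m : F) : F :=
  (a * b * m ^+ 2 + S * (a - lam) * (b - lam)) * ((m + kap) ^+ 2 + S)
  + k * (a + b) * m ^+ 2 * (m + kap) + k ^+ 2 * m ^+ 2
  - S * k * (a + b - 2 * lam) * m.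

(** Write al = a - lam, be = b - lam. If all roots had nonpositive real part, then
    p0 >= 0 would force be >= 0 and p1 >= 0 would force n >= 0 (with n as in the
    proof). But then p4 p1^2 + p0 p3^2 - p1 p2 p3 is a sum of products of
    nonnegative numbers, one of which is positive. *)
Lemma transverse_charpoly_unstable (R : rcfType) (k I S lam a b : R) :
  0 < k -> 0 < I -> 0 < S -> 0 < lam -> lam < a -> 0 < b ->
  exists m : R[i], 0 < complex.Re m /\
    transverse_charpoly k%:C (k / I)%:C S%:C lam%:C a%:C b%:C m = 0.
Proof.
move=> k0 I0 S0 lam0 lama b0; apply: contrapT => /forallNP noroot.
set kap := k / I in noroot *; have kap0 : 0 < kap by rewrite divr_gt0.
have kE : k = I * kap by rewrite mulrC divfK // gt_eqF.
pose al := a - lam; pose be := b - lam.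
have aE : a = lam + al by rewrite /al; ring.
have bE : b = lam + be by rewrite /be; ring.
have al0 : 0 < al by rewrite subr_gt0.
pose n := 2 * al * be - I * (al + be).
pose m := 2 * a * b + I * (a + b).
have a0 : 0 < a by exact: lt_trans lama.
have Ige0 := ltW I0; have lamge0 := ltW lam0; have alge0 := ltW al0.
have m0 : 0 < m by rewrite /m addr_gt0 // !(mulr_gt0, addr_gt0).
have [] := @quartic_hurwitz R (a * b) (kap * m)
   (a * b * (kap ^+ 2 + S) + k * kap * (a + b) + k ^+ 2 + S * al * be)
   (kap * S * n) (S * al * be * (kap ^+ 2 + S)) (mulr_gt0 a0 b0).
  move=> z zroot; rewrite leNgt; apply/negP => zpos; apply: (noroot z); split => //.
  rewrite -zroot /transverse_charpoly /n /m kE /al /be.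
  by rewrite !(rmorphD, rmorphB, rmorphM, rmorphXn, rmorph_nat) /=; ring.
have kapS0 : 0 < kap * S by exact: mulr_gt0.
rewrite (pmulr_rge0 _ kapS0) => n0.
have kS0 : 0 < kap ^+ 2 + S by rewrite addr_gt0 // exprn_gt0.
have Sal0 : 0 < S * al by exact: mulr_gt0.
rewrite (pmulr_lge0 _ kS0) (pmulr_rge0 _ Sal0) => be0.
rewrite leNgt => /negP; apply; rewrite -subr_gt0.
have -> : a * b * (kap * S * n) ^+ 2
    + S * al * be * (kap ^+ 2 + S) * (kap * m) ^+ 2
    - kap * S * n * (a * b * (kap ^+ 2 + S) + k * kap * (a + b) + k ^+ 2 + S * al * be)
      * (kap * m)
  = kap ^+ 2 * S * I * (
      (n * (a + b) + m * (al + be)) * (S * (lam * (a + be) + I * (lam + al + be)))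
      + m * kap ^+ 2 * (lam * (al * a + be * b)
        + I * (al ^+ 2 + be ^+ 2 + 2 * lam * (al + be)) + I ^+ 2 * (al + be))).
  by rewrite kE /n /m aE bE; field.
(* Opaque abbreviations, so that the sign lemmas apply to them as they stand. *)
clear noroot; clearbody n m al be kap.
have lal : 0 < lam * (al * a).
  by apply: mulr_gt0 => //; apply: mulr_gt0.
apply: mulr_gt0.
  by apply: mulr_gt0 => //; apply: mulr_gt0 => //; apply: exprn_gt0.
apply: ltr_wpDl.
  by do ![done | exact: sqr_ge0 | apply: addr_ge0 | apply: mulr_ge0 | exact: ltW].
apply: mulr_gt0; first by apply: mulr_gt0 => //; apply: exprn_gt0.
rewrite mulrDr -!addrA; apply: ltr_pwDl => //.
by do ![done | exact: sqr_ge0 | apply: addr_ge0 | apply: mulr_ge0 | exact: ltW].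
Qed.

End quartic_stability.

(** * Quadratic maps are continuously differentiable *)

Lemma row_linear_expand (R : realType) (m : nat) (W : lmodType R)
  (g : 'rV[R]_m -> W) : linear g ->
  forall x, g x = \sum_j x 0 j *: g (delta_mx 0 j).
Proof.
move=> lg x.
pose G : {linear 'rV[R]_m -> W} := HB.pack g (GRing.isLinear.Build _ _ _ _ g lg).
rewrite {1}(row_sum_delta x) -[g]/(G : _ -> _) linear_sum.
by apply: eq_bigr => j _; rewrite linearZ.
Qed.

Lemma differentiable_fun_sum (R : numFieldType) (V W : normedModType R) m
  (f : 'I_m -> V -> W) x :
  (forall i, differentiable (f i) x) -> differentiable (fun z => \sum_i f i z) x.
Proof. by move=> df; rewrite -fct_sumE; apply: differentiable_sum. Qed.

Lemma linear_rV_continuous (R : realType) (m : nat) (W : normedModType R)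
  (g : 'rV[R]_m -> W) : linear g -> continuous g.
Proof.
move=> lg x; rewrite (_ : g = fun x => \sum_j x 0 j *: g (delta_mx 0 j));
  last first.
  by apply: funext => y; apply: row_linear_expand.
apply: differentiable_continuous; apply: differentiable_fun_sum => j.
apply: differentiableZl; exact: differentiable_coord.
Qed.

Section quadratic.
Variables (R : realType) (m n : nat) (c : 'rV[R]_n) (l : 'rV[R]_m -> 'rV[R]_n).
Variable (b : 'rV[R]_m -> 'rV[R]_m -> 'rV[R]_n).
Hypotheses (lin_l : linear l) (lin_br : forall u, linear (b u))
  (lin_bl : forall v, linear (b ^~ v)).

Let f z := c + l z + b z z.

Lemma quadratic_differentiable x : differentiable f x.
Proof.
rewrite (_ : f = cst c + (fun z => \sum_j z 0 j *: l (delta_mx 0 j)) +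
  (fun z => \sum_i (\sum_j (z 0 i * z 0 j) *: b (delta_mx 0 i) (delta_mx 0 j))));
  last first.
  apply: funext => z; rewrite /f -[RHS]/(_ + _ + _); congr (_ + _ + _).
    exact: row_linear_expand.
  rewrite (row_linear_expand (lin_bl z)); apply: eq_bigr => i _.
  rewrite (row_linear_expand (lin_br _) z) scaler_sumr; apply: eq_bigr => j _.
  by rewrite scalerA.
apply: differentiableD; first apply: differentiableD.
- exact: differentiable_cst.
- apply: differentiable_fun_sum => j; apply: differentiableZl; exact: differentiable_coord.
- apply: differentiable_fun_sum => i; apply: differentiable_fun_sum => j.
  apply: differentiableZl; apply: differentiableM; exact: differentiable_coord.
Qed.

(** The difference quotient of f at x in the direction v is
    l v + b x v + b v x + h b v v, so the derivative is its value at h = 0. *)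
Lemma quadratic_jacobian x v : v *m jacobian f x = l v + b x v + b v x.
Proof.
rewrite -deriveEjacobian; last exact: quadratic_differentiable.
set w := l v + _ + _; apply: cvg_lim => //.
pose g (h : R) := w + h *: b v v.
have gc : g @ 0 --> w.
  rewrite (_ : w = w + 0 *: b v v); last by rewrite scale0r addr0.
  by apply: cvgD; [exact: cvg_cst | apply: cvgZr_tmp; exact: cvg_id].
apply: (@cvg_trans _ (g @ 0^')); last first.
  by apply: cvg_trans gc; apply: cvg_app; exact: cvg_within.
apply: near_eq_cvg; near=> h.
have h0 : h != 0 by near: h; exact: nbhs_dnbhs_neq.
have lE a u y : l (a *: u + y) = a *: l u + l y by exact: lin_l.
have brE a p u y : b p (a *: u + y) = a *: b p u + b p y by exact: lin_br.
have blE a p u y : b (a *: u + y) p = a *: b u p + b y p by exact: (lin_bl p).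
rewrite /g /w /f /= lE blE !brE.
apply: (scalerI h0); rewrite scalerA divff // scale1r.
rewrite !scalerDr scalerA.
by apply/rowP => j; rewrite !mxE; ring.
Unshelve. all: by end_near.
Qed.

(** The jacobian is an affine function of the base point. *)
Lemma quadratic_C1 D : is_C1 D f.
Proof.
move=> x _; split; first exact: quadratic_differentiable.
pose e (i : 'I_m) : 'rV[R]_m := delta_mx 0 i.
pose H y := \matrix_i (b y (e i) + b (e i) y).
have jacE : jacobian f = fun y => \matrix_i l (e i) + H y.
  apply: funext => y; apply/row_matrixP => i.
  by rewrite raddfD /= !rowK rowE quadratic_jacobian addrA.
have linH : linear H.
  move=> a u v; apply/row_matrixP => i.
  rewrite raddfD /= linearZ /= !rowK lin_br.
  have -> : b (a *: u + v) (e i) = a *: b u (e i) + b v (e i).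
    exact: (lin_bl (e i)).
  by rewrite scalerDr addrACA.
have Hc : {for x, continuous H}.
  exact: (linear_rV_continuous (W := 'M[R]_(m, n)) linH).
rewrite jacE; exact: (cvgD (cvg_cst _) Hc).
Qed.
End quadratic.

(** * Scalar and cross products *)

Section vectors.
Variable R : realType.
Implicit Types (u v w x : 'rV[R]_3) (a : R).

Definition dot u v : R := u 0 0 * v 0 0 + u 0 1 * v 0 1 + u 0 2 * v 0 2.

Lemma row3P u v : u 0 0 = v 0 0 -> u 0 1 = v 0 1 -> u 0 2 = v 0 2 -> u = v.
Proof.
move=> h0 h1 h2; apply/rowP => -[[|[|[|//]]] i3].
- by rewrite (_ : Ordinal i3 = 0) //; apply: val_inj.
- by rewrite (_ : Ordinal i3 = 1) //; apply: val_inj.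
- by rewrite (_ : Ordinal i3 = 2) //; apply: val_inj.
Qed.

Lemma dot_eq0 u : dot u u = 0 -> u = 0.
Proof.
move=> /eqP; rewrite /dot -!expr2 !paddr_eq0 ?addr_ge0 ?sqr_ge0 // !sqrf_eq0.
by move=> /andP[/andP[/eqP h0 /eqP h1] /eqP h2]; apply: row3P; rewrite !mxE.
Qed.

Lemma crossmul_linear_r u : linear (crossmul u).
Proof. by move=> a v w; apply: row3P; rewrite !mxE /=; ring. Qed.

Lemma crossmul_linear_l v : linear (fun u => crossmul u v).
Proof. by move=> a u w; apply: row3P; rewrite !mxE /=; ring. Qed.

Lemma crossmulvv u : crossmul u u = 0.
Proof. by apply: row3P; rewrite !mxE /=; ring. Qed.

Lemma crossmulZr u a v : crossmul u (a *: v) = a *: crossmul u v.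
Proof. by apply: row3P; rewrite !mxE /=; ring. Qed.

Lemma dotZBr x a u v : dot x (a *: u - v) = a * dot x u - dot x v.
Proof. by rewrite /dot !mxE; ring. Qed.

Lemma dot_crossmul_l w u : dot w (crossmul w u) = 0.
Proof. by rewrite /dot !mxE /=; ring. Qed.

Lemma dot_crossmulC w u v : dot u (crossmul w v) = - dot v (crossmul w u).
Proof. by rewrite /dot !mxE /=; ring. Qed.

Lemma dot_crossmul_r w u : dot (crossmul w u) u = 0.
Proof. by rewrite /dot !mxE /=; ring. Qed.

Lemma lagrange_identity w u v :
  dot (crossmul w u) (crossmul w v) = dot w w * dot u v - dot w u * dot w v.
Proof. by rewrite /dot !mxE /=; ring. Qed.

Lemma mulmx_diag3 (A1 A2 A3 : R) u :
  u *m diag3 A1 A2 A3 = \row_j [:: A1 * u 0 0; A2 * u 0 1; A3 * u 0 2]`_j.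
Proof. by rewrite /diag3 mul_mx_diag; apply: row3P; rewrite !mxE /= mulrC. Qed.

Lemma diag3_unit (A1 A2 A3 : R) :
  0 < A1 -> 0 < A2 -> 0 < A3 -> diag3 A1 A2 A3 \in unitmx.
Proof.
move=> h1 h2 h3; rewrite unitmxE det_diag unitfE !big_ord_recl big_ord0 !mxE /=.
by rewrite mulr1 !mulf_neq0 ?gt_eqF.
Qed.

End vectors.

(** * The derivative of the vector field *)

Section linearization.
Variables (R : realType) (k I : R) (J : 'M[R]_3).

Let l (z : 'rV[R]_(3 + 3)) : 'rV[R]_(3 + 3) :=
  row_mx ((k *: (rsubmx z - lsubmx z)) *m invmx J)
    (- (k / I) *: (rsubmx z - lsubmx z)).

Let b (z y : 'rV[R]_(3 + 3)) : 'rV[R]_(3 + 3) :=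
  row_mx (- (crossmul (lsubmx z) (lsubmx y *m J) *m invmx J))
    (- crossmul (lsubmx z) (rsubmx y)).

Let rhsE : rhs k I J = fun z => 0 + l z + b z z.
Proof.
apply: funext => z; rewrite /rhs /l /b add0r add_row_mx; congr row_mx.
by rewrite mulmxBl.
Qed.

Let lin_l : linear l.
Proof.
move=> a z y; rewrite /l scale_row_mx add_row_mx !linearP /=; congr row_mx.
  rewrite scalemxAl -mulmxDl; congr (_ *m _).
  by apply/rowP => j; rewrite !mxE; ring.
by apply/rowP => j; rewrite !mxE; ring.
Qed.

Let lin_br z : linear (b z).
Proof.
move=> a x y; rewrite /b scale_row_mx add_row_mx !linearP /=; congr row_mx.
  rewrite mulmxDl -scalemxAl crossmul_linear_r mulmxDl -scalemxAl.
  by rewrite scalerN opprD.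
by rewrite crossmul_linear_r scalerN opprD.
Qed.

Let lin_bl y : linear (b ^~ y).
Proof.
have cl (v : 'rV[R]_3) (a : R) (u w : 'rV[R]_3) : 
    crossmul (a *: u + w) v = a *: crossmul u v + crossmul w v.
  exact: (@crossmul_linear_l R v a u w).
move=> a x z; rewrite /b scale_row_mx add_row_mx !linearP /=; congr row_mx.
  by rewrite cl mulmxDl -scalemxAl scalerN opprD.
by rewrite cl scalerN opprD.
Qed.

Lemma rhs_C1 D : is_C1 D (rhs k I J).
Proof. by rewrite rhsE; apply: quadratic_C1. Qed.

Lemma rhs_jacobian (lam : R) (w u v : 'rV[R]_3) : w *m J = lam *: w ->
  row_mx u v *m jacobian (rhs k I J) (row_mx w w) =
  row_mx ((k *: (v - u) - crossmul w (u *m J - lam *: u)) *m invmx J)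
         (- (k / I) *: (v - u) - crossmul w (v - u)).
Proof.
move=> wJ; rewrite rhsE quadratic_jacobian // /l /b !row_mxKl !row_mxKr.
rewrite !add_row_mx wJ; congr row_mx.
  rewrite -!mulNmx -!mulmxDl; congr (_ *m _).
  by apply: row3P; rewrite !mxE /=; ring.
by apply: row3P; rewrite !mxE /=; ring.
Qed.

End linearization.

(** * Spectrum in real terms *)

(** The eigenvector is x + i y; separating real and imaginary parts lets the rest
    of the argument use real vectors only. *)
Lemma spectrum_re_im (R : realType) (n : nat) (A : 'M[R]_n) (mu : R[i]) :
  spectrum A mu <-> exists x y : 'rV[R]_n, [/\ (x != 0) || (y != 0),
    x *m A = complex.Re mu *: x - complex.Im mu *: y
  & y *m A = complex.Im mu *: x + complex.Re mu *: y].
Proof.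
case: mu => rho tau /=; split.
- move=> /eigenvalueP[v vA v0].
  exists (map_mx (@complex.Re R) v), (map_mx (@complex.Im R) v).
  have entry j : \sum_i v 0 i * (A i j)%:C%C = (rho +i* tau)%C * v 0 j.
    have /rowP /(_ j) := vA; rewrite !mxE => <-; apply: eq_bigr => i _.
    by rewrite mxE.
  split.
  + apply: contra_neqT v0; rewrite negb_or !negbK => /andP[/eqP x0 /eqP y0].
    apply/rowP => j; apply/eqP; rewrite eq_complex.
    have /rowP /(_ j) := x0; have /rowP /(_ j) := y0.
    by rewrite !mxE => -> ->; rewrite !eqxx.
  + apply/rowP => j; have /(congr1 (@complex.Re R)) := entry j; rewrite !mxE.
    rewrite raddf_sum; case: (v 0 j) => p q /= <-; apply: eq_bigr => i _.
    by rewrite mxE; case: (v 0 i) => ? ?; simpc.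
  + apply/rowP => j; have /(congr1 (@complex.Im R)) := entry j; rewrite !mxE.
    rewrite raddf_sum; case: (v 0 j) => p q /=; rewrite addrC => <-.
    apply: eq_bigr => i _.
    by rewrite mxE; case: (v 0 i) => ? ?; simpc.
- move=> [x [y [xy0 xA yA]]].
  apply/eigenvalueP; exists (\row_j (x 0 j +i* y 0 j)%C).
    apply/rowP => j; rewrite !mxE; apply/eqP; rewrite eq_complex; apply/andP.
    have /rowP /(_ j) := xA; have /rowP /(_ j) := yA; rewrite !mxE => yE xE.
    rewrite !raddf_sum; split; apply/eqP => /=.
      by rewrite -xE; apply: eq_bigr => i _; rewrite !mxE; simpc.
    by rewrite addrC -yE; apply: eq_bigr => i _; rewrite !mxE; simpc.
  apply: contraTneq xy0 => /rowP h; rewrite negb_or !negbK.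
  by apply/andP; split; apply/eqP/rowP => j; have := h j; rewrite !mxE => -[].
Qed.

(** * Linearization at a relative equilibrium *)

Section relative_equilibrium.
Variables (R : realType) (k I A1 A2 A3 lam : R) (w : 'rV[R]_3).
Hypotheses (k0 : 0 < k) (I0 : 0 < I) (A1gt0 : 0 < A1) (A2gt0 : 0 < A2)
  (A3gt0 : 0 < A3) (lam0 : 0 < lam).

Let J := diag3 A1 A2 A3.
Hypotheses (w0 : w != 0) (wJ : w *m J = lam *: w).

Let A := jacobian (rhs k I J) (row_mx w w).

Let Junit : J \in unitmx. Proof. exact: diag3_unit. Qed.

Implicit Types u v n : 'rV[R]_3.

Let defect (u : 'rV[R]_3) := u *m J - lam *: u.

(** Multiplying the first component by J avoids the inverse matrix. *)
Lemma linearizationP (u v u' v' : 'rV[R]_3) : row_mx u v *m A = row_mx u' v' <->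
  u' *m J = k *: (v - u) - crossmul w (defect u) /\
  v' = - (k / I) *: (v - u) - crossmul w (v - u).
Proof.
rewrite (rhs_jacobian _ _ _ _ wJ); split=> [/eq_row_mx[<- <-]|[h ->]].
  by rewrite mulmxKV.
by congr row_mx; rewrite -[u' in RHS](mulmxK Junit) h.
Qed.

Let ww0 : 0 < dot w w.
Proof.
rewrite lt_def; apply/andP; split; first by apply: contra w0 => /eqP /dot_eq0 ->.
by rewrite /dot -!expr2 !addr_ge0 ?sqr_ge0.
Qed.

Lemma dot_eigenvector_defect n u : n *m J = lam *: n -> dot n (defect u) = 0.
Proof.
move=> nJ; have -> : dot n (defect u) = dot (n *m J - lam *: n) u.
  by rewrite /defect /J !mulmx_diag3 /dot !mxE /=; ring.
by rewrite nJ subrr /dot !mxE !mul0r !addr0.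
Qed.

(** The product of the second equation with v - u gives v = u. What remains,
    w x (u J - lam u) = 0, makes u J - lam u parallel to w; it is also orthogonal
    to w, hence zero. *)
Lemma kernelP (u v : 'rV[R]_3) : row_mx u v *m A = 0 <-> v = u /\ u *m J = lam *: u.
Proof.
rewrite -row_mx0 linearizationP mul0mx; split=> [[h1 h2]|[-> uJ]]; last first.
  rewrite /defect uJ !subrr; split; apply: row3P; rewrite !mxE /=; ring.
have y0 : v - u = 0.
  apply: dot_eq0; apply/eqP.
  have kI0 : - (k / I) != 0 by rewrite oppr_eq0 gt_eqF // divr_gt0.
  rewrite -(mulrI_eq0 _ (mulfI kI0)) -[X in _ == X](_ : dot (v - u) 0 = 0); last first.
    by rewrite /dot !mxE !mulr0 !addr0.
  by rewrite h2 /dot !mxE /=; apply/eqP; ring.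
split; first by apply/eqP; rewrite -subr_eq0 y0.
move: h1; rewrite y0 scaler0 sub0r => /esym/eqP; rewrite oppr_eq0 => /eqP c0.
apply/eqP; rewrite -subr_eq0 -/(defect u); apply/eqP; apply: dot_eq0.
have := lagrange_identity w (defect u) (defect u).
rewrite c0 (dot_eigenvector_defect _ wJ) mul0r subr0.
move/esym/eqP; rewrite /dot !mxE !mul0r !addr0 mulf_eq0 => /orP[|/eqP //].
by rewrite -/(dot w w) gt_eqF.
Qed.

(** Let (u, v) be mapped to (n, n) with n J = lam n, and put y = v - u. The
    products of the two equations with w give n . w = 0. The product of the first
    with w x n then gives y . (w x n) = 0, and that of the second with w x n gives
    y . n = 0, so that the product of the second with n becomes n . n = 0. *)
Lemma kernel_semisimple : (kermx (A *m A) :=: kermx A)%MS.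
Proof.
apply/eqmxP/andP; split; last by apply/sub_kermxP; rewrite mulmxA mulmx_ker mul0mx.
apply/rV_subP => z /sub_kermxP; rewrite mulmxA => zAA; apply/sub_kermxP.
move: zAA; rewrite -[z]hsubmxK; set u := lsubmx z; set v := rsubmx z.
rewrite -[row_mx u v *m A]hsubmxK; set n := lsubmx _.
move=> /kernelP[nE nJ]; rewrite nE.
have /linearizationP [e1 e2] : row_mx u v *m A = row_mx n n.
  by rewrite -{2}nE /n hsubmxK.
rewrite nJ in e1.
have kI0 : 0 < k / I by rewrite divr_gt0.
have kIE : k = I * (k / I) by rewrite mulrC divfK // gt_eqF.
have wn : dot w n = 0.
  have := congr1 (dot w) e1; have := congr1 (dot w) e2.
  rewrite !dotZBr !dot_crossmul_l !subr0 -[lam *: n]subr0 dotZBr => d2.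
  have -> : dot w 0 = 0 by rewrite /dot !mxE; ring.
  rewrite subr0 => d1; apply/eqP.
  have lI : lam + I != 0 by rewrite gt_eqF // addr_gt0.
  rewrite -(mulrI_eq0 _ (mulfI lI)) mulrDl d1 d2 {1}kIE; apply/eqP; ring.
have yp : dot (crossmul w n) (v - u) = 0.
  have := congr1 (dot (crossmul w n)) e1.
  rewrite dotZBr lagrange_identity wn (dot_eigenvector_defect _ nJ).
  rewrite mulr0 mul0r !subr0 -[lam *: n]subr0 dotZBr dot_crossmul_r.
  have -> : dot (crossmul w n) 0 = 0 by rewrite /dot !mxE; ring.
  by rewrite mulr0 subr0 => /esym/eqP; rewrite mulf_eq0 gt_eqF //= => /eqP.
have yn : dot n (v - u) = 0.
  have := congr1 (dot (crossmul w n)) e2.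
  rewrite dotZBr lagrange_identity wn dot_crossmul_r yp mulr0 mul0r subr0 sub0r.
  by move/esym/eqP; rewrite oppr_eq0 mulf_eq0 gt_eqF //= => /eqP.
have n0 : n = 0.
  apply: dot_eq0; rewrite {2}e2 dotZBr yn dot_crossmulC.
  rewrite mulr0 sub0r opprK -[RHS]yp /dot; ring.
by rewrite n0 row_mx0.
Qed.

Let eigenrows := row_base (kermx (J - lam%:M)).

Let eigenrowsP u : (u <= eigenrows)%MS <-> u *m J = lam *: u.
Proof.
rewrite eq_row_base; split=> [/sub_kermxP|uJ]; last apply/sub_kermxP.
  by rewrite mulmxBr mul_mx_scalar => /eqP; rewrite subr_eq0 => /eqP.
by rewrite mulmxBr mul_mx_scalar uJ subrr.
Qed.

Lemma diagonal_equilibrium u : u *m J = lam *: u -> rhs k I J (row_mx u u) = 0.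
Proof.
move=> uJ; rewrite /rhs row_mxKl row_mxKr uJ crossmulZr crossmulvv subrr !scaler0.
by rewrite subrr mul0mx row_mx0.
Qed.

(** The chart is the affine map with linear part u |-> (u, u) on the eigenspace of
    J for lam: all its values are equilibria. *)
Lemma equilibrium_manifold : exists m U (psi : 'rV[R]_m -> 'rV[R]_(3 + 3)),
  [/\ (0 < m <= 3 + 3)%N,
      equilibrium_chart setT (rhs k I J) (row_mx w w) U psi
    & (jacobian psi 0 :=: kermx A)%MS].
Proof.
pose E := row_mx eigenrows eigenrows.
pose b0 (x y : 'rV[R]_(\rank (kermx (J - lam%:M)))) : 'rV[R]_(3 + 3) := 0.
pose psi x := row_mx w w + x *m E + b0 x x.
have linE : linear (mulmx^~ E : 'rV[R]_(\rank (kermx (J - lam%:M))) -> _).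
  by move=> a x y; rewrite /= mulmxDl scalemxAl.
have lin0r x : linear (b0 x) by move=> a y t; rewrite /b0 scaler0 addr0.
have lin0l y : linear (b0^~ y) by move=> a x t; rewrite /b0 scaler0 addr0.
have psiJ : jacobian psi 0 = E.
  by apply/row_matrixP => i; rewrite !rowE quadratic_jacobian // /b0 !addr0.
have wE : (w <= eigenrows)%MS by apply/eigenrowsP.
exists _, setT, psi; split.
- rewrite lt0n mxrank_eq0; apply/andP; split; last first.
    by rewrite (leq_trans (rank_leq_row _)).
  apply: contra w0 => /eqP K0.
  by move: wE; rewrite eq_row_base K0 submx0.
- split.
  + by split; first exact: openT.
  + exact: quadratic_C1.
  + move=> _ [x _ <-]; split => //.
    rewrite /psi /b0 addr0 mul_mx_row add_row_mx; apply: diagonal_equilibrium.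
    by apply/eigenrowsP; rewrite addmx_sub // submxMl.
  + by rewrite /psi /b0 mul0mx !addr0.
  + rewrite psiJ (_ : E = eigenrows *m row_mx 1%:M 1%:M); last first.
      by rewrite mul_mx_row mulmx1.
    rewrite mxrankMfree; first by rewrite /eigenrows eq_row_base.
    apply/row_freeP; exists (col_mx 1%:M 0).
    by rewrite mul_row_col mulmx1 mulmx0 addr0.
- rewrite psiJ; apply/eqmxP/andP; split.
    apply/rV_subP => _ /submxP[x ->]; apply/sub_kermxP.
    rewrite mul_mx_row; apply/kernelP; split => //.
    by apply/eigenrowsP; rewrite submxMl.
  apply/rV_subP => z /sub_kermxP; rewrite -[z]hsubmxK.
  move=> /kernelP[-> /eigenrowsP /submxP[x ->]].
  by rewrite -mul_mx_row submxMl.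
Qed.

(** The symmetric bilinear form of the second derivative at (w, w) of the energy
    minus |M|^2 / (2 (lam + I)), where M = Omega J + I Omega1 is the angular
    momentum. The multiple of |M|^2 is the one that makes (w, w) critical. *)
Definition energy u v u' v' : R :=
  dot u (u' *m J) + I * dot v v'
  - dot (u *m J + I *: v) (u' *m J + I *: v') / (lam + I).

Lemma energyC u v u' v' : energy u v u' v' = energy u' v' u v.
Proof. by rewrite /energy /J !mulmx_diag3 /dot !mxE /=; ring. Qed.

Lemma energyD u v s t s' t' (a b : R) :
  energy u v (a *: s + b *: s') (a *: t + b *: t')
    = a * energy u v s t + b * energy u v s' t'.
Proof. by rewrite /energy mulmxDl -!scalemxAl /dot !mxE; ring. Qed.

(** The linearized form of the decay of the energy at the rate k |Omega1 - Omega|^2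
    while |M| is constant. *)
Lemma energy_dissipation u v u' v' : row_mx u v *m A = row_mx u' v' ->
  energy u v u' v' = - k * dot (v - u) (v - u).
Proof.
move=> /linearizationP[e1 e2]; rewrite /energy e1 e2 /defect /J !mulmx_diag3.
rewrite /dot !mxE /=.
have lI : lam + I != 0 by rewrite gt_eqF // addr_gt0.
have I0' : I != 0 by rewrite gt_eqF.
by field; rewrite I0' lI.
Qed.

(** Apply the dissipation identity to the real and the imaginary part of an
    eigenvector; the mixed terms cancel because the form is symmetric. If both
    differences v - u and t - s were zero, the equation for the second components
    would give mu v = 0, hence a zero eigenvector. *)
Lemma energy_eigenvector (mu : R[i]) : spectrum A mu -> mu != 0 ->
  exists u v s t, 0 < dot (v - u) (v - u) + dot (t - s) (t - s) /\
    complex.Re mu * (energy u v u v + energy s t s t)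
      = - k * (dot (v - u) (v - u) + dot (t - s) (t - s)).
Proof.
case: mu => rho tau; rewrite eq_complex /= negb_and => /spectrum_re_im.
move=> [x [y [xy0]]] /= xA yA mu0.
move: xA yA xy0; rewrite -[x]hsubmxK -[y]hsubmxK.
move: (lsubmx x) (rsubmx x) (lsubmx y) (rsubmx y) => u v s t {x y}.
rewrite !scale_row_mx opp_row_mx !add_row_mx => xA yA xy0.
exists u, v, s, t; split.
  have dge0 n : 0 <= dot n n by rewrite /dot -!expr2 !addr_ge0 ?sqr_ge0.
  rewrite lt_def addr_ge0 // andbT paddr_eq0 //; apply: contraTN xy0.
  move=> /andP[/eqP /dot_eq0 uv /eqP /dot_eq0 st].
  move/linearizationP: xA => [_]; move/linearizationP: yA => [_].
  have d0 : - (k / I) *: (0 : 'rV[R]_3) - crossmul w 0 = 0.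
    by rewrite -[X in crossmul w X](scale0r w) crossmulZr scale0r scaler0 subrr.
  rewrite uv st d0 => e1 e2.
  have sq0 : rho ^+ 2 + tau ^+ 2 != 0.
    by rewrite paddr_eq0 ?sqr_ge0 // !sqrf_eq0 negb_and.
  have v0 : v = 0.
    apply: (scalerI sq0); rewrite scaler0 -[RHS]addr0 -{1}(scaler0 _ rho) -{1}e2.
    rewrite -(scaler0 _ tau) -e1; apply: row3P; rewrite !mxE; ring.
  have t0 : t = 0.
    apply: (scalerI sq0); rewrite scaler0 -[RHS]subr0 -{1}(scaler0 _ rho) -{1}e1.
    rewrite -(scaler0 _ tau) -e2; apply: row3P; rewrite !mxE; ring.
  move: uv st; rewrite v0 t0 !sub0r => /eqP; rewrite oppr_eq0 => /eqP->.
  by move/eqP; rewrite oppr_eq0 => /eqP->; rewrite row_mx0 eqxx.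
have := energy_dissipation xA; have := energy_dissipation yA.
rewrite -!scaleNr !energyD (energyC s t u v) => e1 e2.
rewrite [RHS]mulrDr -e1 -e2; ring.
Qed.

Lemma spectrum_zero : spectrum A 0.
Proof.
apply/spectrum_re_im; exists (row_mx w w), 0; split.
- by apply/orP; left; apply: contra w0; rewrite -row_mx0 => /eqP/eq_row_mx[-> _].
- by rewrite /= !scale0r subr0; apply/kernelP.
- by rewrite /= !scale0r addr0 mul0mx.
Qed.

Lemma relative_equilibrium_regular :
  regular_equilibrium setT (rhs k I J) (row_mx w w).
Proof.
split.
- split; [exact: openT | exact: rhs_C1 |].
  by split => //; exact: diagonal_equilibrium.
- exact: equilibrium_manifold.
- exact: kernel_semisimple.
- apply/seteqP; split=> [mu [muA mu_im]|_ ->]; last first.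
    by split => //; exact: spectrum_zero.
  apply: contrapT => /eqP mu0.
  have [u [v [s [t [pos]]]]] := energy_eigenvector muA mu0.
  rewrite [complex.Re mu]mu_im mul0r => /esym/eqP.
  by rewrite mulf_eq0 oppr_eq0 !gt_eqF.
Qed.

(** In each coordinate,
      (lam + I) (a x^2 + I y^2) - (a x + I y)^2
        = (lam - a) (a x^2 + I y^2) + a I (x - y)^2. *)
Lemma energy_ge0 u v : A1 <= lam -> A2 <= lam -> A3 <= lam ->
  0 <= energy u v u v.
Proof.
move=> le1 le2 le3; have lI : 0 < lam + I by rewrite addr_gt0.
pose q a x y := (lam - a) * (a * x ^+ 2 + I * y ^+ 2) + a * I * (x - y) ^+ 2.
have q0 a x y : 0 < a -> a <= lam -> 0 <= q a x y.
  move=> a0 al; have Ige0 := ltW I0; have age0 := ltW a0.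
  have sub0 : 0 <= lam - a by rewrite subr_ge0.
  by rewrite /q; do ![done | exact: sqr_ge0 | apply: addr_ge0 | apply: mulr_ge0].
have -> : energy u v u v = (q A1 (u 0 0) (v 0 0) + q A2 (u 0 1) (v 0 1)
    + q A3 (u 0 2) (v 0 2)) / (lam + I).
  rewrite /energy /q /J !mulmx_diag3 /dot !mxE /=; field; exact: lt0r_neq0.
apply: divr_ge0; last exact: ltW.
by apply: addr_ge0; [apply: addr_ge0 |]; apply: q0.
Qed.

Lemma normally_stable_top : A1 <= lam -> A2 <= lam -> A3 <= lam ->
  normally_stable setT (rhs k I J) (row_mx w w).
Proof.
move=> le1 le2 le3; split; first exact: relative_equilibrium_regular.
move=> mu [muA /eqP mu0].
have [u [v [s [t [pos E]]]]] := energy_eigenvector muA mu0.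
rewrite /left_half_plane /=; rewrite ltNge; apply/negP => re0.
have : 0 <= - k * (dot (v - u) (v - u) + dot (t - s) (t - s)).
  by rewrite -E mulr_ge0 // addr_ge0 // energy_ge0.
by rewrite mulNr oppr_ge0 leNgt mulr_gt0.
Qed.

(** On the invariant plane of the (c w, c' w) the cross products vanish, and the
    difference of the two angular velocities decays at the rate k / I + k / lam. *)
Lemma spectrum_left : spectrum A `&` @left_half_plane R !=set0.
Proof.
pose mu : R := - (k / I + k / lam).
exists mu%:C%C; split; last first.
  by rewrite /left_half_plane /= oppr_lt0 addr_gt0 // divr_gt0.
have In0 : I != 0 by rewrite gt_eqF.
have ln0 : lam != 0 by rewrite gt_eqF.
apply/spectrum_re_im; exists (row_mx (I *: w) (- lam *: w)), 0; split.
- apply/orP; left; apply: contra w0; rewrite -row_mx0 => /eqP/eq_row_mx[+ _].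
  by move=> /eqP; rewrite scaler_eq0 (negPf In0).
- rewrite /= scaler0 subr0 scale_row_mx; apply/linearizationP; split.
  + rewrite /defect -!scalemxAl wJ.
    by rewrite /mu; apply: row3P; rewrite !mxE /=; field; rewrite In0 ln0.
  + by rewrite /mu; apply: row3P; rewrite !mxE /=; field; rewrite In0 ln0.
- by rewrite /= scale0r scaler0 addr0 mul0mx.
Qed.

(** * Instability when lam is not the largest moment of inertia *)

Section transverse.
Hypotheses (lam_lt : lam < A3) (lam12 : lam = A1 \/ lam = A2).

Let S := dot w w.

(** As lam <> A3, the vector w is orthogonal to e3. It is an eigenvector for A1 or
    A2, so w x e3 is one for the other of the two (for both if they are equal);
    in all cases its eigenvalue is A1 + A2 - lam. *)
Let b := A1 + A2 - lam.

(** The vector c1 e3 + c2 (w x e3). *)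
Let pl (c1 c2 : R) : 'rV[R]_3 := \row_j [:: c2 * w 0 1; - (c2 * w 0 0); c1]`_j.

Let w_coord : [/\ (A1 - lam) * w 0 0 = 0, (A2 - lam) * w 0 1 = 0 & w 0 2 = 0].
Proof.
have := wJ; rewrite /J mulmx_diag3 => /rowP E.
have := E 0; have := E 1; have := E 2; rewrite !mxE /= => e2 e1 e0; split.
- by rewrite mulrBl e0 subrr.
- by rewrite mulrBl e1 subrr.
- have : (A3 - lam) * w 0 2 = 0 by rewrite mulrBl e2 subrr.
  by move/eqP; rewrite mulf_eq0 subr_eq0 gt_eqF //= => /eqP.
Qed.

(** The linearized equations in the basis e3, w x e3, where w x (w x e3) is
    - S e3. *)
Lemma linearization_transverse (u1 u2 v1 v2 u1' u2' v1' v2' : R) :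
  A3 * u1' = k * (v1 - u1) + S * (b - lam) * u2 ->
  b * u2' = k * (v2 - u2) - (A3 - lam) * u1 ->
  v1' = - (k / I) * (v1 - u1) + S * (v2 - u2) ->
  v2' = - (k / I) * (v2 - u2) - (v1 - u1) ->
  row_mx (pl u1 u2) (pl v1 v2) *m A = row_mx (pl u1' u2') (pl v1' v2').
Proof.
have [w0E w1E w2E] := w_coord.
have a0 : A1 * w 0 0 = lam * w 0 0 by apply/eqP; rewrite -subr_eq0 -mulrBl w0E.
have a1 : A2 * w 0 1 = lam * w 0 1 by apply/eqP; rewrite -subr_eq0 -mulrBl w1E.
move=> e1 e2 -> ->; apply/linearizationP; split.
  rewrite /defect /J !mulmx_diag3; apply: row3P; rewrite !mxE /= ?w2E.
  + have -> : A1 * (u2' * w 0 1) = b * u2' * w 0 1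
        - (A2 * w 0 1 - lam * w 0 1) * u2'.
      by rewrite /b; ring.
    by rewrite a1 subrr mul0r subr0 e2; ring.
  + have -> : A2 * - (u2' * w 0 0) = - (b * u2') * w 0 0
        + (A1 * w 0 0 - lam * w 0 0) * u2'.
      by rewrite /b; ring.
    by rewrite a0 subrr mul0r addr0 e2; ring.
  + rewrite e1 /S /b /dot w2E.
    have -> : A1 * (u2 * w 0 1) = (A1 + A2 - lam) * u2 * w 0 1
        - (A2 * w 0 1 - lam * w 0 1) * u2.
      by ring.
    have -> : A2 * - (u2 * w 0 0) = - ((A1 + A2 - lam) * u2) * w 0 0
        + (A1 * w 0 0 - lam * w 0 0) * u2.
      by ring.
    by rewrite a0 a1 !subrr !mul0r; ring.
by apply: row3P; rewrite /S /dot !mxE /= ?w2E; ring.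
Qed.

Lemma spectrum_transverse (mu u1 u2 v1 v2 : R[i]) : u2 != 0 ->
  (A3%:C * (mu * u1) = k%:C * (v1 - u1) + (S * (b - lam))%:C * u2)%C ->
  (b%:C * (mu * u2) = k%:C * (v2 - u2) - (A3 - lam)%:C * u1)%C ->
  (mu * v1 = - (k / I)%:C * (v1 - u1) + S%:C * (v2 - u2))%C ->
  (mu * v2 = - (k / I)%:C * (v2 - u2) - (v1 - u1))%C ->
  spectrum A mu.
Proof.
case: mu u1 u2 v1 v2 => [rho tau] [p1 q1] [p2 q2] [r1 s1] [r2 s2] u20.
simpc => -[e1 f1] [e2 f2] [e3 f3] [e4 f4].
apply/spectrum_re_im; exists (row_mx (pl p1 p2) (pl r1 r2)),
  (row_mx (pl q1 q2) (pl s1 s2)).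
have plE x1 x2 y1 y2 x y : x *: pl x1 x2 + y *: pl y1 y2
    = pl (x * x1 + y * y1) (x * x2 + y * y2).
  by apply: row3P; rewrite !mxE /=; ring.
split => /=.
- have pl0 c1 c2 : pl c1 c2 = 0 -> c2 = 0.
    move=> /rowP c0; have [_ _ w2E] := w_coord; apply: contraNeq w0 => c2n0.
    have := c0 0; have := c0 1; rewrite !mxE /= => /eqP.
    rewrite oppr_eq0 mulf_eq0 (negPf c2n0) => /eqP h0 /eqP.
    rewrite mulf_eq0 (negPf c2n0) => /eqP h1.
    by apply/eqP/row3P; rewrite mxE.
  apply: contraNT u20; rewrite negb_or !negbK -row_mx0.
  move=> /andP[/eqP/eq_row_mx[/pl0 -> _] /eqP/eq_row_mx[/pl0 -> _]].
  by rewrite eqxx.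
- rewrite -!scaleNr !scale_row_mx !add_row_mx !plE.
  by apply: linearization_transverse; lra.
- rewrite !scale_row_mx !add_row_mx !plE.
  by apply: linearization_transverse; lra.
Qed.

(** Elimination of v1 - u1 and v2 - u2 from the equations of [spectrum_transverse]
    leaves two homogeneous equations for u1 and u2 with determinant a multiple of
    the transverse polynomial. The vector used here solves the first one; it has
    been multiplied by D = (mu + kap)^2 + S to clear denominators. *)
Lemma spectrum_right : spectrum A `&` @right_half_plane R !=set0.
Proof.
have b0 : 0 < b.
  by rewrite /b; case: lam12 => ->; [rewrite addrAC subrr add0r | rewrite addrK].
have [mu [mupos P0]] := transverse_charpoly_unstable k0 I0 ww0 lam0 lam_lt b0.
exists mu; split=> //.
pose kap := k / I; have kap0 : 0 < kap by rewrite divr_gt0.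
pose nu := (mu + kap%:C)%C; pose D := (nu ^+ 2 + S%:C)%C.
have nupos : 0 < complex.Re nu.
  by rewrite /nu; case: (mu) mupos => x y /= xpos; rewrite addr_gt0.
have D0 : D != 0.
  have := quadratic_nonroot ltr01 (lexx 0) ww0 nupos.
  by rewrite rmorph1 rmorph0 mul1r mul0r addr0.
pose c1 := (S%:C * ((b - lam)%:C * D - k%:C * mu))%C.
pose c2 := (mu * (A3%:C * D + k%:C * nu))%C.
have c20 : c2 != 0.
  apply: mulf_neq0; first by apply: contraTneq mupos => ->; rewrite ltxx.
  have -> : (A3%:C * D + k%:C * nu = A3%:C * nu ^+ 2 + k%:C * nu + (A3 * S)%:C)%C.
    by rewrite /D rmorphM /=; ring.
  exact: quadratic_nonroot A3gt0 (ltW k0) (mulr_gt0 A3gt0 ww0) nupos.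
have PD : (D * transverse_charpoly k%:C kap%:C S%:C lam%:C A3%:C b%:C mu)%C = 0.
  by rewrite P0 mulr0.
pose y1 := (- mu * (nu * c1 + S%:C * c2))%C.
pose y2 := (- mu * (nu * c2 - c1))%C.
apply: (@spectrum_transverse mu (D * c1) (D * c2) (D * c1 + y1) (D * c2 + y2)).
- exact: mulf_neq0.
- rewrite /y1 /c1 /c2 /D /nu !(rmorphB, rmorphM) /=; ring.
- apply/eqP; rewrite -subr_eq0 -[X in _ == X]PD /transverse_charpoly; apply/eqP.
  rewrite /y2 /c1 /c2 /D /nu !(rmorphB, rmorphM) /=; ring.
- rewrite /y1 /y2 -/kap /D /nu; ring.
- rewrite /y1 /y2 -/kap /D /nu; ring.
Qed.

End transverse.

End relative_equilibrium.

Theorem theorem10 (R : realType) (k I A1 A2 A3 lambda : R)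
    (Omega Omega1 : 'rV[R]_3) :
  let J := diag3 A1 A2 A3 in
  let f := rhs k I J in
  let z := row_mx Omega Omega1 in
  0 < k -> 0 < I -> 0 < A1 -> A1 <= A2 -> A2 <= A3 ->
  equilibria setT f z ->
  Omega = Omega1 ->
  lambda \in [:: A1; A2; A3] ->
  is_eigenvector J lambda Omega ->
  (lambda = A3 -> normally_stable setT f z) /\
  (lambda <> A3 -> normally_hyperbolic setT f z).
Proof.
move=> J f z k0 I0 A10 A12 A23 _ OmegaE; rewrite /z -OmegaE.
have A20 : 0 < A2 := lt_le_trans A10 A12.
have A30 : 0 < A3 := lt_le_trans A20 A23.
rewrite !inE => lamA; case=> Omega0 OmegaJ.
have lam0 : 0 < lambda by case/or3P: lamA => /eqP ->.
split=> [lam3 | /eqP lam3].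
  apply: (normally_stable_top (lam := lambda)) => //; rewrite lam3 //.
  exact: le_trans A23.
have lam12 : lambda = A1 \/ lambda = A2.
  by case/or3P: lamA => /eqP E; [left | right | rewrite E eqxx in lam3].
have lamA3 : lambda < A3.
  rewrite lt_def eq_sym lam3 /=; case: lam12 => -> //; exact: le_trans A23.
split.
- exact: (relative_equilibrium_regular (lam := lambda)).
- exact: (spectrum_left (lam := lambda)).
- exact: (spectrum_right (lam := lambda)).
Qed.
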